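(* Let $(X,\tau_X,\mathfrak{a})$ and $(Y,\tau_Y,\mathfrak{b})$ be aura topological spaces. Then $$\tau_{\mathfrak{a}}\times\tau_{\mathfrak{b}}\subseteq\tau_{\mathfrak{a}\times\mathfrak{b}}\subseteq\tau_X\times\tau_Y$$ as topologies on $X\times Y$.
   Context: An aura topological space $(X,\tau,\mathfrak{a})$ is a topological space $(X,\tau)$ together with a function $\mathfrak{a}:X\to\tau$ (a scope function) such that $x\in\mathfrak{a}(x)$ for every $x\in X$. A subset $A\subseteq X$ is $\mathfrak{a}$-open if $\mathfrak{a}(x)\subseteq A$ for every $x\in A$; the collection $\tau_{\mathfrak{a}}$ of all $\mathfrak{a}$-open sets is a topology on $X$ with $\tau_{\mathfrak{a}}\subseteq\tau$. For topologies $\sigma$ on $X$ and $\rho$ on $Y$, $\sigma\times\rho$ denotes the product topology on $X\times Y$. The product aura space of $(X,\tau_X,\mathfrak{a})$ and $(Y,\tau_Y,\mathfrak{b})$ is $(X\times Y,\tau_X\times\tau_Y,\mathfrak{a}\times\mathfrak{b})$, where $(\mathfrak{a}\times\mathfrak{b})(x,y)=\mathfrak{a}(x)\times\mathfrak{b}(y)$; thus $\tau_{\mathfrak{a}\times\mathfrak{b}}$ consists of all $W\subseteq X\times Y$ with $\mathfrak{a}(x)\times\mathfrak{b}(y)\subseteq W$ for every $(x,y)\in W$. *)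

(* Defs.v *)
From HB Require Import structures.
From mathcomp Require Import all_boot all_order all_algebra.
From mathcomp Require Import all_classical topology.

Set Implicit Arguments.
Unset Strict Implicit.
Unset Printing Implicit Defensive.

Local Open Scope classical_set_scope.

Definition open_sets (T : topologicalType) : set_system T := @open T.
Arguments open_sets : clear implicits.

Record auraType := AuraType {
  aura_sort :> topologicalType;
  scope : aura_sort -> set aura_sort;
  scope_open : forall x, open (scope x);
  scope_refl : forall x, scope x x }.

Definition aura_open (X : auraType) : set_system X :=
  [set A | forall x, A x -> scope x `<=` A].

(* A copy of the carrier of X whose topology is the family of aura-open sets
   instead of the original topology. *)
Definition aura_topology (X : auraType) : Type := aura_sort X.

Section AuraTopology.
Variable X : auraType.

HB.instance Definition _ := Choice.on (aura_topology X).

Let aura_openT : aura_open [set: X].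
Proof. by []. Qed.

Let aura_openI : setI_closed (@aura_open X).
Proof.
move=> A B oA oB x [Ax Bx] y xy.
by split; [exact: (oA x Ax)|exact: (oB x Bx)].
Qed.

Let aura_open_bigcup (I : Type) (f : I -> set X) :
  (forall i, aura_open (f i)) -> aura_open (\bigcup_i f i).
Proof. by move=> of_ x [i _ fix_] y xy; exists i => //; exact: (of_ i x). Qed.

HB.instance Definition _ := @isOpenTopological.Build (aura_topology X)
  (@aura_open X) aura_openT aura_openI aura_open_bigcup.

Lemma aura_topologyE : open_sets (aura_topology X) = @aura_open X.
Proof. by []. Qed.

End AuraTopology.

Section AuraProduct.
Variables X Y : auraType.

Definition prod_scope (p : X * Y) : set (X * Y) := scope p.1 `*` scope p.2.

Lemma prod_scope_open p : open (prod_scope p).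
Proof.
rewrite openE => q [px py]; exists (scope p.1, scope p.2) => //.
by split; apply: open_nbhs_nbhs; split => //; exact: scope_open.
Qed.

Lemma prod_scope_refl p : prod_scope p p.
Proof. by split; exact: scope_refl. Qed.

Definition prod_aura : auraType := AuraType prod_scope_open prod_scope_refl.

End AuraProduct.

(* Main.v *)
Require Import Defs.
From mathcomp Require Import all_boot all_order all_algebra.
From mathcomp Require Import all_classical topology.

Local Open Scope classical_set_scope.

(** Every aura neighbourhood of a point contains its scope, so a box of such neighbourhoods contains
    the product of scopes. That product is itself open for the original topologies, so an aura-open
    set is a neighbourhood of each of its points. *)

Lemma nbhs_aura_scope (X : auraType) (x : aura_topology X)
  (A : set (aura_topology X)) : nbhs x A -> @scope X x `<=` A.
Proof.
rewrite nbhsE => -[B [oB Bx] BA].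
rewrite -[open B]/(open_sets (aura_topology X) B) aura_topologyE in oB.
exact: subset_trans (oB x Bx) BA.
Qed.

Theorem theorem5p9 (X Y : auraType) :
  open_sets (aura_topology X * aura_topology Y)%type
    `<=` open_sets (aura_topology (prod_aura X Y)) /\
  open_sets (aura_topology (prod_aura X Y)) `<=` open_sets (X * Y)%type.
Proof.
split=> W; rewrite aura_topologyE => oW.
- move=> p Wp q [q1 q2].
  (* [A] and [B] are the sides of a box around [p] inside [W]. *)
  have [[A B] /= [nA nB] ABW] := open_nbhs_nbhs (conj oW Wp).
  by apply: ABW; split; [exact: nbhs_aura_scope nA _ q1|exact: nbhs_aura_scope nB _ q2].
- rewrite /open_sets openE => p Wp.
  (* [prod_scope p] is the neighbourhood of [p] inside [W]. *)
  apply: filterS (oW p Wp) _.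
  apply: open_nbhs_nbhs; split; [exact: prod_scope_open|exact: prod_scope_refl].
Qed.
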